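(* Let $\Phi$ be the root system of type $B_n$ and $1\le d\le 2n-1$. Then \[ \operatorname{Var}(\mathcal{X}_{\Phi^+_{=d}})=\begin{cases} \frac1{24}d+\frac1{12}n+\frac1{12} & d\le\frac n2,\ d\text{ even},\\ \frac1{24}d+\frac1{12}n+\frac1{24} & d\le\frac n2,\ d\text{ odd},\\ \frac1{24}d+\frac1{12}n+\frac16 & \frac n2<d\le\frac23 n,\ d\text{ even},\\ \frac1{24}d+\frac1{12}n+\frac18 & \frac n2<d\le\frac23 n,\ d\text{ odd},\\ \frac1{24}d+\frac1{12}n & \frac23 n<d\le n,\ d\text{ even},\\ \frac1{24}d+\frac1{12}n+\frac18 & \frac23 n\le d\le n,\ d\text{ odd},\\ -\frac18 d+\frac14 n & n\le d,\ d\text{ even},\\ -\frac18 d+\frac14 n+\frac18 & n\le d,\ d\text{ odd}, \end{cases} \] \[ \operatorname{Var}(\mathcal{X}_{\Phi^+_{\le d}})=\begin{cases} \frac1{36}d^3+\frac1{48}d^2+(\frac1{12}n+\frac1{72})d & d\le\frac n2,\ d\text{ even},\\ \frac1{36}d^3+\frac1{48}d^2+(\frac1{12}n+\frac1{72})d+\frac1{48} & d\le\frac n2,\ d\text{ odd},\\ \frac1{36}d^3+\frac3{16}d^2+(-\frac1{12}n+\frac7{72})d+(\frac1{24}n^2-\frac1{24}n) & \frac n2\le d\le\frac23 n,\ d\text{ even},\\ \frac1{36}d^3+\frac3{16}d^2+(-\frac1{12}n+\frac7{72})d+(\frac1{24}n^2-\frac1{24}n+\frac1{48}) & \frac n2\le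 d<\frac23 n,\ d\text{ odd},\\ \frac1{36}d^3+(\frac16 n-\frac1{36})d+(-\frac1{24}n^2+\frac1{24}n) & \frac23 n\le d\le n,\ d\text{ even},\\ \frac1{36}d^3+(\frac16 n+\frac7{72})d+(-\frac1{24}n^2-\frac1{24}n+\frac1{24}) & \frac23 n\le d\le n,\ d\text{ odd},\\ -\frac1{12}d^3+(\frac13 n-\frac1{24})d^2+(-\frac13 n^2+\frac16 n-\frac1{24})d+(\frac19 n^3+\frac1{18}n) & n\le d,\ d\text{ even},\\ -\frac1{12}d^3+(\frac13 n-\frac1{24})d^2+(-\frac13 n^2+\frac16 n+\frac1{12})d+(\frac19 n^3-\frac1{36}n+\frac1{24}) & n\le d,\ d\text{ odd}. \end{cases} \]
   Context: Type $B_n$ is realized in $\mathbb{R}^n$ with standard basis $e_1,\dots,e_n$: simple roots $e_1$ and $e_{i+1}-e_i$ ($1\le i<n$); positive roots $e_i$ ($1\le i\le n$) and $e_j\pm e_i$ ($1\le i<j\le n$); all roots are $\pm e_i$ and $\pm e_j\pm e_i$. Heights: $\operatorname{ht}(e_j-e_i)=j-i$, $\operatorname{ht}(e_i)=i$, $\operatorname{ht}(e_j+e_i)=j+i$. The Weyl group $W$ is the group of signed permutations of $\{\pm1,\dots,\pm n\}$. $\Phi^+_{=d}$ (resp. $\Phi^+_{\le d}$) is the set of positive roots of height exactly $d$ (resp. at most $d$). For $\beta\in\Phi^+$, $\mathcal{X}_\beta$ is the Bernoulli random variable on $W$ (uniform) with $\mathcal{X}_\beta(w)=1$ if $w(\beta)$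 is a negative root and $0$ otherwise; $\mathcal{X}_\Psi=\sum_{\beta\in\Psi}\mathcal{X}_\beta$. *)

(* Defs.v *)
From HB Require Import structures.
From mathcomp Require Import all_boot all_order all_fingroup all_algebra.
Set Implicit Arguments. Unset Strict Implicit. Unset Printing Implicit Defensive.
Import Order.TTheory GRing.Theory Num.Theory.
Local Open Scope ring_scope.

(* vectors of R^n with integer coordinates; coordinate k : 'I_n stands for e_(k+1) *)
Definition vec (n : nat) := {ffun 'I_n -> int}.

Definition ebase (n : nat) (i : 'I_n) : vec n := [ffun k => (k == i)%:R].

(* positive roots of B_n, each paired with its height (1-based indices):
   e_i (height i), e_j - e_i (height j - i), e_j + e_i (height j + i), i < j *)
Definition posroots_ht (n : nat) : seq (vec n * nat) :=
  [seq (ebase i, i.+1) | i : 'I_n <- enum 'I_n] ++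
  flatten [seq [seq (ebase j - ebase i, (j.+1 - i.+1)%N)
                   | j <- filter (fun j : 'I_n => (i < j)%N) (enum 'I_n)]
            | i : 'I_n <- enum 'I_n] ++
  flatten [seq [seq (ebase j + ebase i, (j.+1 + i.+1)%N)
                   | j <- filter (fun j : 'I_n => (i < j)%N) (enum 'I_n)]
            | i : 'I_n <- enum 'I_n].

Definition posroots (n : nat) : seq (vec n) := [seq p.1 | p <- posroots_ht n].

Definition posroots_eq (n d : nat) : seq (vec n) :=
  [seq p.1 | p <- posroots_ht n & p.2 == d].
Definition posroots_le (n d : nat) : seq (vec n) :=
  [seq p.1 | p <- posroots_ht n & (p.2 <= d)%N].

(* The Weyl group W of B_n: signed permutations, w = (sigma, s) acting by
   w(e_i) = (-1)^(s i) e_(sigma i). *)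
Definition weyl (n : nat) : finType := ({perm 'I_n} * {ffun 'I_n -> bool})%type.

Definition wact (n : nat) (w : weyl n) (v : vec n) : vec n :=
  [ffun k => let i := ((w.1)^-1)%g k in (if w.2 i then -1 else 1) * v i].

Definition is_neg_root (n : nat) (v : vec n) : bool := (- v) \in posroots n.

Definition Xb (n : nat) (beta : vec n) (w : weyl n) : nat :=
  is_neg_root (wact w beta).
Definition XPsi (n : nat) (Psi : seq (vec n)) (w : weyl n) : nat :=
  (\sum_(beta <- Psi) Xb beta w)%N.

Definition Ew (n : nat) (f : weyl n -> rat) : rat :=
  (\sum_(w : weyl n) f w) / #|weyl n|%:R.
Definition Var (n : nat) (X : weyl n -> nat) : rat :=
  Ew (fun w => (X w)%:R ^+ 2) - (Ew (fun w => (X w)%:R)) ^+ 2.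

(* Main.v *)
(** Let [Y b = 1 - 2 X_b] be the sign of [w b]. If [w = (sigma, eps)], a long root [e_j + c e_i]
    has the sign [eps_j] or [c eps_i] according to which of [sigma j], [sigma i] is larger.
    Hence the sum of all the [Y b] is [sum_i eps_i Z_i], where [Z_i] depends on [sigma]
    only. The [eps_i] are uncorrelated, so its second moment is the sum of those of
    the [Z_i], which only involve P(sigma i > sigma j) = 1/2 and
    P(sigma i > sigma j, sigma k) = 1/3. The variance becomes a sum over coordinates of a
    quadratic expression in the coordinates of the sum of the long roots. For height
    [= d] these are sums of indicators of intervals; for height [<= d] they are
    affine between the breakpoints [d/2], [n - d], [d], [d - n]. *)

Require Import Defs.
From HB Require Import structures.
From mathcomp Require Import all_boot all_order all_fingroup all_algebra.
From mathcomp Require Import zify ring lra.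
Set Implicit Arguments. Unset Strict Implicit. Unset Printing Implicit Defensive.
Import Order.TTheory GRing.Theory Num.Theory.
Local Open Scope ring_scope.

(** * Moments of signs and comparisons *)

Section Expectation.
Variable n : nat.
Implicit Types (f g : weyl n -> rat) (w : weyl n) (i j k : 'I_n).

Lemma Ew_eq f g : f =1 g -> Ew f = Ew g.
Proof. by move=> fg; rewrite /Ew (eq_bigr g). Qed.

Lemma EwD f g : Ew (fun w => f w + g w) = Ew f + Ew g.
Proof. by rewrite /Ew big_split mulrDl. Qed.

Lemma EwZ c f : Ew (fun w => c * f w) = c * Ew f.
Proof. by rewrite /Ew -mulr_sumr mulrA. Qed.

Lemma Ew_sum (I : finType) (F : I -> weyl n -> rat) :
  Ew (fun w => \sum_i F i w) = \sum_i Ew (F i).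
Proof. by rewrite /Ew exchange_big mulr_suml. Qed.

Lemma Ew_cst (c : rat) : Ew (fun _ : weyl n => c) = c.
Proof.
rewrite /Ew sumr_const -[c *+ _]mulr_natr mulfK // pnatr_eq0 -lt0n.
by apply/card_gt0P; exists (1%g, [ffun=> false]).
Qed.

Lemma Ew_reindex (h : weyl n -> weyl n) f :
  injective h -> Ew f = Ew (f \o h).
Proof. by move=> inj_h; rewrite /Ew (reindex_inj inj_h). Qed.

Definition eps w i : rat := (-1) ^+ w.2 i.
Definition gt_at w i j : rat := (w.1 j < w.1 i)%N%:R.

(** Changes of variables for the uniform law: [flip i] negates only the sign at [i]; [swap i j]
    exchanges the values of the permutation at [i] and [j], since a product applies its left factor
    first. *)
Definition flip i w : weyl n := (w.1, [ffun k => w.2 k (+) (k == i)]).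
Definition swap i j w : weyl n := ((tperm i j * w.1)%g, w.2).

Lemma flip_inj i : injective (flip i).
Proof.
apply: (can_inj (g := flip i)) => -[s e]; congr pair; apply/ffunP=> k.
by rewrite !ffunE addbK.
Qed.

Lemma swap_inj i j : injective (swap i j).
Proof. by move=> [s e] [s' e'] [/mulgI-> ->]. Qed.

Lemma eps_flip i w j : eps (flip i w) j = (-1) ^+ (j == i) * eps w j.
Proof. by rewrite /eps ffunE signr_addb mulrC. Qed.

Lemma gt_at_swap i j w k l :
  gt_at (swap i j w) k l = gt_at w (tperm i j k) (tperm i j l).
Proof. by rewrite /gt_at !permM. Qed.

(** [flip i] negates the integrand, so the expectation is its own opposite. The next two lemmas use
    the same symmetry, which fixes the permutation and the other signs. *)
Lemma Ew_eps i : Ew (fun w => eps w i) = 0.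
Proof.
have := Ew_reindex (fun w => eps w i) (@flip_inj i).
under [X in _ = X]Ew_eq => w do rewrite /= eps_flip eqxx.
by rewrite EwZ; lra.
Qed.

Lemma Ew_eps_gt i j : Ew (fun w => eps w i * gt_at w i j) = 0.
Proof.
have := Ew_reindex (fun w => eps w i * gt_at w i j) (@flip_inj i).
under [X in _ = X]Ew_eq => w do rewrite /= eps_flip eqxx -mulrA.
by rewrite EwZ; lra.
Qed.

Lemma Ew_eps_eps i j (g : {perm 'I_n} -> rat) : i != j ->
  Ew (fun w => eps w i * eps w j * g w.1) = 0.
Proof.
move=> ij.
have := Ew_reindex (fun w => eps w i * eps w j * g w.1) (@flip_inj i).
under [X in _ = X]Ew_eq => w do
  rewrite /= !eps_flip eqxx eq_sym (negPf ij) mul1r -!mulrA.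
under [X in X = _ -> _]Ew_eq => w do rewrite -mulrA.
under [X in _ -> X = _]Ew_eq => w do rewrite -mulrA.
by rewrite EwZ; lra.
Qed.

Lemma eps_sqr w i : eps w i * eps w i = 1.
Proof. by rewrite -expr2 sqrr_sign. Qed.

Lemma gt_atii w i : gt_at w i i = 0.
Proof. by rewrite /gt_at ltnn. Qed.

Lemma perm_ltn_total w i j : i != j -> (w.1 i < w.1 j)%N = ~~ (w.1 j < w.1 i)%N.
Proof.
move=> ij; have : w.1 i != w.1 j by rewrite (inj_eq perm_inj).
by rewrite -val_eqE /=; lia.
Qed.

(** [swap i j] exchanges two complementary events. *)
Lemma Ew_gt i j : i != j -> Ew (fun w => gt_at w i j) = 1 / 2.
Proof.
move=> ij; have := Ew_reindex (fun w => gt_at w i j) (@swap_inj i j).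
under [X in _ = X -> _]Ew_eq => w do rewrite /= gt_at_swap tpermL tpermR.
have: Ew (fun w => gt_at w i j + gt_at w j i) = 1.
  rewrite -[RHS]Ew_cst; apply: Ew_eq => w.
  by rewrite /gt_at (perm_ltn_total w ij); case: (_ < _)%N.
by rewrite EwD; lra.
Qed.

(** Exactly one of [i], [j], [k] has the largest image, and swaps make the three cases equally
    likely. *)
Lemma Ew_gt_gt i j k : i != j -> i != k -> j != k ->
  Ew (fun w => gt_at w i j * gt_at w i k) = 1 / 3.
Proof.
move=> ij ik jk; pose M a b c w := gt_at w a b * gt_at w a c.
have := Ew_reindex (M i j k) (@swap_inj i j).
rewrite (@Ew_eq (M i j k \o swap i j) (M j i k)); last first.
  by move=> w; rewrite /= /M !gt_at_swap tpermL tpermR tpermD.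
have := Ew_reindex (M i j k) (@swap_inj i k).
rewrite (@Ew_eq (M i j k \o swap i k) (M k i j)); last first.
  by move=> w; rewrite /= /M !gt_at_swap tpermL tpermR tpermD // 1?mulrC // eq_sym.
have: Ew (fun w => M i j k w + M j i k w + M k i j w) = 1.
  rewrite -[RHS]Ew_cst; apply: Ew_eq => w; rewrite /M /gt_at.
  rewrite (perm_ltn_total w ij) (perm_ltn_total w ik) (perm_ltn_total w jk).
  by case: ltnP => ?; case: ltnP => ?; case: ltnP => ? /=; (lia || lra).
by rewrite !EwD -/(M i j k); lra.
Qed.

Lemma Ew_gt_gtE i j k : i != j -> i != k ->
  Ew (fun w => gt_at w i j * gt_at w i k) = 1 / 3 + (j == k)%:R / 6.
Proof.
move=> ij ik; case: (eqVneq j k) => [<-|jk]; last by rewrite Ew_gt_gt //; lra.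
under Ew_eq => w do rewrite -natrM mulnb andbb.
by rewrite (Ew_gt ij) /=; lra.
Qed.

(* Distinct signs are uncorrelated, so only the diagonal terms survive in the
   second moment; there [P(i beats j) = 1/2] and
   [P(i beats j and k) = 1/3]. *)
Lemma Ew_quad (s : 'I_n -> rat) (a : 'I_n -> 'I_n -> rat) :
    (forall i, a i i = 0) ->
  Ew (fun w => (\sum_i eps w i * (s i + \sum_j a i j * gt_at w i j)) ^+ 2) =
  \sum_i (s i ^+ 2 + s i * \sum_j a i j + (\sum_j a i j) ^+ 2 / 3
          + (\sum_j a i j ^+ 2) / 6).
Proof.
move=> a0; pose Z i w : rat := s i + \sum_j a i j * gt_at w i j.
have -> : Ew (fun w => (\sum_i eps w i * Z i w) ^+ 2) = \sum_i Ew (fun w => Z i w ^+ 2).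
  under Ew_eq => w do rewrite expr2 mulr_suml.
  rewrite Ew_sum; apply: eq_bigr => i _.
  under Ew_eq => w do rewrite mulr_sumr.
  rewrite Ew_sum (bigD1 i) //= [X in _ + X]big1 ?addr0 => [|j ji].
    by apply: Ew_eq => w; rewrite mulrACA eps_sqr mul1r -expr2.
  under Ew_eq => w do rewrite mulrACA.
  (* [Z i * Z j] is a function of the permutation alone, the form required by [Ew_eps_eps]. *)
  pose zz i (p : {perm 'I_n}) : rat := s i + \sum_j a i j * (p j < p i)%N%:R.
  by rewrite -(@Ew_eps_eps i j (fun p => zz i p * zz j p)) // eq_sym.
apply: eq_bigr => i _.
rewrite (@Ew_eq _ (fun w => s i ^+ 2 + (2 * s i * (\sum_j a i j * gt_at w i j)
   + \sum_j \sum_k a i j * a i k * (gt_at w i j * gt_at w i k)))); last first.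
  move=> w; rewrite /Z.
  have -> : \sum_j \sum_k a i j * a i k * (gt_at w i j * gt_at w i k) =
            (\sum_j a i j * gt_at w i j) ^+ 2.
    rewrite expr2 mulr_suml; apply: eq_bigr => j _; rewrite mulr_sumr.
    by apply: eq_bigr => k _; rewrite mulrACA.
  by ring.
rewrite EwD Ew_cst EwD EwZ !Ew_sum -!addrA; congr (_ + _).
congr (_ + _).
  rewrite (eq_bigr (fun j => a i j * (1 / 2))) => [|j _].
    by rewrite -mulr_suml; field.
  rewrite EwZ; case: (eqVneq i j) => [->|ij]; first by rewrite a0 !mul0r.
  by rewrite (Ew_gt ij).
rewrite expr2 !mulr_suml -big_split; apply: eq_bigr => j _ /=.
(* The 1/3 gives the square of the row sum, the diagonal correction 1/6 the sum of squares. *)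
rewrite Ew_sum (eq_bigr (fun k => a i j * a i k / 3 + (a i j * (j == k)%:R / 6) * a i k)).
  rewrite big_split -mulr_suml -mulr_sumr; congr (_ + _).
  rewrite (bigD1 j) //= eqxx /= big1 ?addr0 => [|k kj]; first by field.
  by rewrite eq_sym (negPf kj) /=; field.
move=> k _; rewrite EwZ.
case: (eqVneq i j) => [->|ij]; first by rewrite a0 !mul0r addr0.
case: (eqVneq i k) => [->|ik]; first by rewrite a0 mulr0 !mul0r mulr0 addr0.
by rewrite Ew_gt_gtE //; field.
Qed.

(** [Y] is affine in [X] with slope -2, so it has four times the variance; being centred, its
    variance is its second moment. *)
Lemma Var_affine (X : weyl n -> nat) (m : rat) (Y : weyl n -> rat) :
  (forall w, m - 2 * (X w)%:R = Y w) -> Ew Y = 0 ->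
  Var X = Ew (fun w => Y w ^+ 2) / 4.
Proof.
move=> XY Y0; rewrite /Var.
have XE w : (X w)%:R = 1 / 2 * m + (- (1 / 2)) * Y w by rewrite -XY; field.
under Ew_eq => w do rewrite XE.
under [X in _ - X ^+ 2]Ew_eq => w do rewrite XE.
rewrite EwD Ew_cst EwZ Y0.
rewrite (@Ew_eq _ (fun w => m ^+ 2 / 4 + ((- m / 2) * Y w + 1 / 4 * Y w ^+ 2))).
  by rewrite EwD Ew_cst EwD !EwZ Y0; field.
by move=> w; field.
Qed.

End Expectation.

(** * Signs of the images of the roots *)

Section Roots.
Variable n : nat.
Implicit Types (w : weyl n) (i j k : 'I_n) (v : vec n).

Definition isign (b : bool) : int := if b then -1 else 1.

Lemma posrootsP v :
  reflect [\/ exists i, v = ebase i,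
              exists i j, (i < j)%N /\ v = ebase j - ebase i |
              exists i j, (i < j)%N /\ v = ebase j + ebase i]
          (v \in posroots n).
Proof.
rewrite /posroots /posroots_ht; apply: (iffP mapP) => [[[u h]]|].
  rewrite !mem_cat => /or3P[].
  - by case/mapP=> i _ [-> _] ->; apply: Or31; exists i.
  - case/flatten_mapP=> i _ /mapP[j]; rewrite mem_filter => /andP[ij _] [-> _] ->.
    by apply: Or32; exists i, j.
  - case/flatten_mapP=> i _ /mapP[j]; rewrite mem_filter => /andP[ij _] [-> _] ->.
    by apply: Or33; exists i, j.
case=> [[i ->]|[i [j [ij ->]]]|[i [j [ij ->]]]].
- exists (ebase i, i.+1) => //; rewrite !mem_cat; apply/or3P; apply: Or31.
  by apply/mapP; exists i => //; rewrite mem_enum.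
- exists (ebase j - ebase i, (j.+1 - i.+1)%N) => //; rewrite !mem_cat.
  apply/or3P; apply: Or32; apply/flatten_mapP; exists i; rewrite ?mem_enum //.
  by apply/mapP; exists j => //; rewrite mem_filter ij mem_enum.
- exists (ebase j + ebase i, (j.+1 + i.+1)%N) => //; rewrite !mem_cat.
  apply/or3P; apply: Or33; apply/flatten_mapP; exists i; rewrite ?mem_enum //.
  by apply/mapP; exists j => //; rewrite mem_filter ij mem_enum.
Qed.

(** Used contrapositively: a vector whose nonzero coordinate of highest index is -1 is not a
    positive root. *)
Lemma posroot_lead v i : v \in posroots n -> v i != 0 ->
  (forall k, (i < k)%N -> v k = 0) -> v i = 1.
Proof.
have ltE (a b : 'I_n) : (a < b)%N -> (a == b) = false.
  by rewrite -val_eqE /=; lia.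
case/posrootsP=> [[a ->]|[a [b [ab ->]]]|[a [b [ab ->]]]]; rewrite !ffunE.
- by case: (i == a); rewrite ?mulr0n ?eqxx.
- case: (eqVneq i b) => [->|ib]; first by rewrite [b == a]eq_sym ltE.
  case: (eqVneq i a) => [->|ia]; last by [].
  by move=> _ /(_ b ab); rewrite !ffunE eqxx [b == a]eq_sym ltE.
- case: (eqVneq i b) => [->|ib]; first by rewrite [b == a]eq_sym ltE.
  by case: (eqVneq i a).
Qed.

Lemma neg_root1 (b : bool) i :
  is_neg_root ([ffun k => isign b * (ebase i) k] : vec n) = b.
Proof.
rewrite /is_neg_root /isign; case: b.
  apply/posrootsP/Or31; exists i; apply/ffunP=> k.
  by rewrite !ffunE mulN1r opprK.
apply/negP=> /(@posroot_lead _ i); rewrite !ffunE eqxx => H.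
suff: (- (1 * true%:R) : int) = 1 by [].

by apply: H => // k ik; rewrite !ffunE -val_eqE /= gtn_eqF // mulr0 oppr0.
Qed.

(** The larger index carries the leading coordinate, so its sign decides; [c] only selects between a
    sum and a difference of basis vectors. *)
Lemma neg_root2 (b c : bool) i j : (j < i)%N ->
  is_neg_root ([ffun k => isign b * (ebase i) k + isign c * (ebase j) k] : vec n) = b.
Proof.
move=> ji; rewrite /is_neg_root /isign; case: b.
  case: c; apply/posrootsP; [apply: Or33|apply: Or32]; exists j, i; split=> //;
    by apply/ffunP=> k; rewrite !ffunE; lia.
apply/negP=> /(@posroot_lead _ i); rewrite !ffunE eqxx.
have -> : (i == j) = false by rewrite -val_eqE /=; lia.
rewrite mulr0 addr0 => H.
(* The leading coordinate is -1, and -1 = 1 is refuted by computation. *)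
suff: (- (1 * true%:R) : int) = 1 by [].

apply: H => // k ik; rewrite !ffunE.
have -> : (k == i) = false by rewrite -val_eqE /=; lia.
have -> : (k == j) = false by rewrite -val_eqE /=; lia.
by rewrite !mulr0.
Qed.

Lemma wact_ebase w i k : wact w (ebase i) k = isign (w.2 i) * (ebase (w.1 i)) k.
Proof.
rewrite !ffunE /= ?ffunE; have -> : (w.1^-1%g k == i) = (k == w.1 i).
  by apply/eqP/eqP => [<-|->]; rewrite ?permKV ?permK.
by case: eqP => [->|_]; rewrite ?permK ?mulr0.
Qed.

Lemma Xb_ebase w i : 1 - 2 * (Xb (ebase i) w)%:R = eps w i :> rat.
Proof.
rewrite /Xb (_ : wact w _ = [ffun k => isign (w.2 i) * ebase (w.1 i) k]); last first.
  by apply/ffunP=> k; rewrite wact_ebase [RHS]ffunE.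
by rewrite neg_root1 /eps; case: (w.2 i).
Qed.

(** [c = true] is e_j - e_i, [c = false] is e_j + e_i. The image has coordinates 1 or -1 at [w.1 j]
    and [w.1 i], and [neg_root2] reads the sign at the larger index. *)
Lemma Xb_long w i j (c : bool) (v : vec n) : i != j ->
  (forall k, v k = ebase j k + isign c * ebase i k) ->
  1 - 2 * (Xb v w)%:R =
  eps w j * gt_at w j i + (-1) ^+ c * (eps w i * gt_at w i j) :> rat.
Proof.
move=> ij vE; rewrite /Xb.
have wv k : wact w v k = isign (w.2 j) * ebase (w.1 j) k
                         + isign (w.2 i (+) c) * ebase (w.1 i) k.
  rewrite -[isign (w.2 j) * _]wact_ebase.
  have -> : isign (w.2 i (+) c) * ebase (w.1 i) k = isign c * wact w (ebase i) k.
    by rewrite wact_ebase /isign; case: c {vE} => //; case: (w.2 i);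
       rewrite ?mulN1r ?mul1r ?opprK.
  rewrite [LHS]ffunE /= vE mulrDr [in RHS]/wact [in RHS]ffunE [X in _ + _ * X]ffunE /=.
  by rewrite [isign c * (_ * _)]mulrCA.
rewrite /gt_at -(negbK (w.1 i < w.1 j)%N) -(perm_ltn_total w) 1?eq_sym //.
case: ltnP => [ji|]; last first.
  rewrite leq_eqVlt val_eqE (inj_eq perm_inj) (negPf ij) /= => ij'.
  rewrite (_ : wact w v = [ffun k => isign (w.2 j) * ebase (w.1 j) k
                         + isign (w.2 i (+) c) * ebase (w.1 i) k]).
    by rewrite neg_root2 // /eps; case: (w.2 j) => /=; field.
  by apply/ffunP=> k; rewrite wv [RHS]ffunE.
rewrite (_ : wact w v = [ffun k => isign (w.2 i (+) c) * ebase (w.1 i) k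
                         + isign (w.2 j) * ebase (w.1 j) k]).
  by rewrite neg_root2 // /eps; case: (w.2 i); case: c {vE wv} => /=; field.
by apply/ffunP=> k; rewrite wv [RHS]ffunE addrC.
Qed.

(** * Sums over the roots whose height satisfies [P] *)

Variable P : pred nat.

Definition roots_in : seq (vec n) := [seq p.1 | p <- posroots_ht n & P p.2].

(** Total e_i-coordinate of the selected long roots supported on [i] and [j]. Indices start at 0,
    whence [i + j + 2]. *)
Definition rcoef i j : rat :=
  if (j < i)%N then (P (i + j + 2)%N)%:R + (P (i - j)%N)%:R
  else if (i < j)%N then (P (i + j + 2)%N)%:R - (P (j - i)%N)%:R else 0.

Lemma sum_roots_in (f : vec n -> rat) :
  \sum_(v <- roots_in) f v =
  \sum_(i < n) (P i.+1)%:R * f (ebase i)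
  + \sum_(i < n) \sum_(j < n | (i < j)%N) ((P (j - i)%N)%:R * f (ebase j - ebase i)
     + (P (i + j + 2)%N)%:R * f (ebase j + ebase i)).
Proof.
have bE (b : bool) (x : rat) : b%:R * x = if b then x else 0.
  by case: b; rewrite ?mul1r ?mul0r.
rewrite /roots_in big_map big_filter /posroots_ht !big_cat /=; congr (_ + _).
  rewrite big_map big_enum_cond /= big_mkcond.
  by apply: eq_bigr => i _; rewrite bE.
rewrite !big_flatten !big_map -big_split /=.
apply: eq_bigr => i _; rewrite !big_map !big_filter_cond /= big_split /=.
congr (_ + _); rewrite big_mkcondr; apply: eq_bigr => j ij; rewrite bE ?subSS //.
by rewrite (_ : j.+1 + i.+1 = i + j + 2)%N //; lia.
Qed.

Lemma sum_sign w :
  \sum_(v <- roots_in) (1 - 2 * (Xb v w)%:R) =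
  \sum_i eps w i * ((P i.+1)%:R + \sum_j rcoef i j * gt_at w i j) :> rat.
Proof.
rewrite sum_roots_in.
under [RHS]eq_bigr => i _ do rewrite mulrDr mulr_sumr.
rewrite big_split /=; congr (_ + _).
  by apply: eq_bigr => i _; rewrite Xb_ebase mulrC.
(* [t] collects the terms with sign [eps w i] from long roots in which [i] is the larger index, [u]
   those in which it is the smaller. *)
pose t i j : rat := eps w i * (((P (i + j + 2)%N)%:R + (P (i - j)%N)%:R) * gt_at w i j).
pose u i j : rat := eps w i * (((P (i + j + 2)%N)%:R - (P (j - i)%N)%:R) * gt_at w i j).
transitivity (\sum_(i < n) \sum_(j < n | (i < j)%N) (t j i + u i j)).
  apply: eq_bigr => i _; apply: eq_bigr => j ij.
  have nij : i != j by rewrite -val_eqE /=; lia.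
  rewrite (@Xb_long w i j true) // => [|k]; last by rewrite !ffunE mulN1r.
  rewrite (@Xb_long w i j false) // => [|k]; last by rewrite !ffunE mul1r.
  by rewrite /t /u [(j + i)%N]addnC; ring.
transitivity (\sum_(i < n) \sum_(j < n | (j < i)%N) t i j
              + \sum_(i < n) \sum_(j < n | (i < j)%N) u i j).
  rewrite [X in _ = X + _](exchange_big_dep xpredT) //= -big_split /=.
  by apply: eq_bigr => i _; rewrite -big_split.
rewrite -big_split /=.
apply: eq_bigr => i _; rewrite !(big_mkcond (fun j : 'I_n => _ < _)%N) /=.
rewrite -big_split /=; apply: eq_bigr => j _; rewrite /rcoef /t /u.
by case: ltngtP => _; rewrite ?add0r ?addr0 ?mul0r ?mulr0.
Qed.

(** For indicators p, q one has (p + q)^2 + (p - q)^2 = 2 (p + q): adding the double sum to its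
    transpose cancels the cross terms. *)
Lemma rcoef_swap_sum :
  \sum_i \sum_j rcoef i j ^+ 2 =
  \sum_(i < n) (\sum_(j < n | (j < i)%N) (P (i - j)%N)%:R + \sum_(j < n | (i < j)%N) (P (j -
    i)%N)%:R
          + \sum_(j < n | j != i) (P (i + j + 2)%N)%:R) :> rat.
Proof.
pose S : rat := \sum_i \sum_j rcoef i j ^+ 2.
pose g i j : rat := if (j < i)%N then (P (i - j)%N)%:R + (P (i + j + 2)%N)%:R
  else if (i < j)%N then (P (j - i)%N)%:R + (P (i + j + 2)%N)%:R else 0.
have -> : \sum_(i < n) (\sum_(j < n | (j < i)%N) (P (i - j)%N)%:R + \sum_(j < n | (i < j)%N) (P
  (j - i)%N)%:R
          + \sum_(j < n | j != i) (P (i + j + 2)%N)%:R) = \sum_i \sum_j g i j.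
  apply: eq_bigr => i _; rewrite !(big_mkcond (fun j : 'I_n => _ < _)%N) /=.
  rewrite (big_mkcond (fun j => j != i)) -!big_split /=; apply: eq_bigr => j _.
  rewrite /g -val_eqE /=.
  by case: ltngtP => _ //=; rewrite ?add0r ?addr0.
suff : S + S = \sum_i \sum_j g i j + \sum_i \sum_j g i j by rewrite /S; lra.
rewrite {2}/S (exchange_big_dep xpredT) //= -!big_split; apply: eq_bigr => i _ /=.
rewrite -!big_split; apply: eq_bigr => j _; rewrite /= /rcoef /g [(j + i)%N]addnC.
by case: ltngtP => _; rewrite ?expr0n ?addr0 //; do 2![case: (P _)].
Qed.

(* [A], [B], [C] are the contributions of [e_k - e_i], [e_i - e_k], [e_k + e_i]: the [k]-th
   coordinate of the sum of the long roots is [A - B + C]. *)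
Lemma Var_roots_in (A B C : nat -> nat) :
  (forall k, k < n -> A k = \sum_(i < n | (i < k)%N) P (k - i))%N ->
  (forall k, k < n -> B k = \sum_(i < n | (k < i)%N) P (i - k))%N ->
  (forall k, k < n -> C k = \sum_(i < n | i != k :> nat) P (k + i + 2))%N ->
  48 * Var (XPsi roots_in) =
  (\sum_(0 <= k < n) (4 * ((A k)%:Z - (B k)%:Z + (C k)%:Z) ^+ 2
     + 2 * ((A k)%:Z + (B k)%:Z + (C k)%:Z)
     + 12 * (P k.+1)%:Z * (1 + ((A k)%:Z - (B k)%:Z + (C k)%:Z))))%:~R.
Proof.
move=> AE BE CE.
have rcE i : \sum_j rcoef i j = (A i)%:R - (B i)%:R + (C i)%:R.
  rewrite AE // BE // CE // !natr_sum !(big_mkcond (fun j : 'I_n => _ < _)%N) /=.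
  rewrite (big_mkcond (fun j : 'I_n => _ != _)) -sumrN -!big_split /=.
  apply: eq_bigr => j _; rewrite /rcoef.
  by case: ltngtP => _ //=; rewrite ?subr0 ?addr0 ?sub0r // addrC.
rewrite (@Var_affine n _ (size roots_in)%:R
  (fun w => \sum_i eps w i * ((P i.+1)%:R + \sum_j rcoef i j * gt_at w i j))).
- rewrite Ew_quad => [|i]; last by rewrite /rcoef ltnn.
  rewrite big_split /= -mulr_suml rcoef_swap_sum.
  rewrite mulr_suml -big_split big_mkord rmorph_sum /= mulr_suml mulr_sumr.
  apply: eq_bigr => i _; rewrite rcE.
  have -> : \sum_(j < n | (j < i)%N) (P (i - j)%N)%:R = (A i)%:R :> rat by rewrite AE // natr_sum.
  have -> : \sum_(j < n | (i < j)%N) (P (j - i)%N)%:R = (B i)%:R :> rat by rewrite BE // natr_sum.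
  have -> : \sum_(j < n | j != i) (P (i + j + 2)%N)%:R = (C i)%:R :> rat by rewrite CE // natr_sum.
  rewrite !(rmorphD, rmorphM, rmorphB, rmorphXn) /=.
  (* 48 clears the 1/4 of [Var_affine] and the 1/3 and 1/6 of [Ew_quad]; the case split makes the
     short-root indicator equal to its square. *)
  by case: (P i.+1) => /=; field.
- move=> w; rewrite -sum_sign big_split /= sumrN -mulr_sumr natr_sum.
  congr (_ - _); by rewrite -sum1_size natr_sum.
- rewrite Ew_sum big1 // => i _.
  under Ew_eq => w do rewrite mulrDr mulr_sumr [X in X + _]mulrC.
  rewrite EwD EwZ Ew_eps mulr0 add0r Ew_sum big1 // => j _.
  by under Ew_eq => w do rewrite mulrCA; rewrite EwZ Ew_eps_gt mulr0.
Qed.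

End Roots.

(** * Roots of height exactly [d] *)

Lemma sum_range n a b : (\sum_(0 <= i < n) (a <= i < b) = minn n b - a)%N.
Proof.
elim: n => [|n IH]; first by rewrite big_geq // min0n.
by rewrite big_nat_recr //= IH; lia.
Qed.

Lemma sum_bool_range n (p : nat -> bool) a b :
  (forall k, (k < n)%N -> p k = (a <= k < b)%N) ->
  \sum_(0 <= k < n) (p k)%:Z = (minn n b - a)%N%:Z.
Proof.
move=> pE; rewrite -sum_range -natz natr_sum.
by rewrite !big_nat; apply: eq_bigr => k /andP[_ /pE->]; rewrite natz.
Qed.

Lemma sum_ord_range n (p q : pred nat) a b :
  (forall i, (i < n)%N -> p i && q i = (a <= i < b)%N) ->
  (\sum_(i < n | p i) q i = minn n b - a)%N.
Proof.
move=> pq; rewrite -sum_range big_mkord big_mkcond; apply: eq_bigr => i _.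
by rewrite -pq //; case: (p i).
Qed.

Lemma sum_ord_neq n (q : pred nat) k : (k < n)%N ->
  (\sum_(i < n | i != k :> nat) q i = \sum_(i < n) q i - q k)%N.
Proof.
move=> kn; rewrite [in RHS](bigD1 (Ordinal kn)) //= addKn.
by apply: eq_bigl => i; rewrite -val_eqE.
Qed.

Section HeightEq.
Variables (n e : nat) (o : bool).
Local Notation d := (e.*2 + o)%N.
Hypothesis d_gt0 : (0 < d)%N.

(** For a fixed height [A], [B], [C] take values 0 and 1, so the quadratic summand is a linear
    combination of indicators of intervals. Writing [d] as [e.*2 + o] exposes its parity to
    [lia]. *)
Lemma Var_eq_count :
  48 * Var (XPsi (posroots_eq n d)) =
  (12 * (n - d)%N%:Z + 6 * (minn n (d - 1) - (d - 1 - n))%N%:Z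
   - 6 * (minn n (e - o) - (e - 1))%N%:Z + 12 * (d <= n)%N%:Z
   - 8 * (n - d - d)%N%:Z - 8 * (minn (n - d) (d - 1))%N%:Z
   + 8 * (minn (n - d) (e - o) - (e - 1))%N%:Z - 12 * (d.*2 <= n)%N%:Z)%:~R.
Proof.
(* The partner of [k] in a sum of height [d] is [d - 2 - k]: [c k] says that it lies in [[0, n)],
   [q k] that it is [k] itself. *)
pose c k := (d - 1 - n <= k < d - 1)%N; pose q k := (k.+1.*2 == d)%N.
rewrite (@Var_roots_in n (fun h => h == d) (fun k => (d <= k)%N) (fun k => (k < n - d)%N)
   (fun k => c k && ~~ q k)); first last.
- move=> k kn; rewrite (@sum_ord_neq n (fun i => k + i + 2 == d)%N) //.
  rewrite (@sum_ord_range n xpredT (fun i => k + i + 2 == d)%N (d - 2 - k) (if k + 2 <= d then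
    d - 1 - k else 0)%N).
    rewrite /c /q; case: ifP; lia.
  move=> i lt_in /=; case: ifP; lia.
- move=> k kn; rewrite (@sum_ord_range n (fun i => k < i)%N (fun i => i - k == d)%N (k + d) (k
    + d + 1)) => [|i]; lia.
(* For [k < d] the truncated [k - d] is 0, so the upper end is set to 0 to keep the interval
   empty. *)
- move=> k kn; rewrite (@sum_ord_range n (fun i => i < k)%N (fun i => k - i == d)%N (k - d) (if
    d <= k then k - d + 1 else 0)%N) => [|i]; case: ifP; lia.
congr (_%:~R).
rewrite (@eq_big_nat _ _ _ _ _ _ (fun k => 6 * (d <= k)%N%:Z + 6 * (k < n - d)%N%:Z
   + 6 * (c k)%:Z - 6 * (q k)%:Z + 12 * (k.+1 == d)%:Z
   - 8 * ((d <= k) && (k < n - d))%N%:Z - 8 * ((k < n - d)%N && c k)%:Z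
   + 8 * ((k < n - d)%N && q k)%:Z - 12 * ((k.+1 == d) && (k < n - d)%N)%:Z)); last first.
  move=> k kn.
  (* [q] implies [c], while [d <= k], [c] and [k.+1 == d] are pairwise disjoint: this eliminates the
     other products. *)
  have qc : q k -> c k by rewrite /q /c; lia.
  have ac : (d <= k)%N -> c k = false by rewrite /c; lia.
  have sa : (k.+1 == d) -> (d <= k)%N = false by lia.
  have sc : (k.+1 == d) -> c k = false by rewrite /c; lia.
  move: qc ac sa sc; case: (d <= k)%N; case: (k < n - d)%N; case: (c k); case: (q k);
  case: (k.+1 == d) => /= qc ac sa sc; try lia;
  by [have := qc isT | have := ac isT | have := sa isT | have := sc isT].
rewrite !(big_split, sumrN) /= -!mulr_sumr.
rewrite (@sum_bool_range n (fun k => d <= k)%N d n); last by lia.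
rewrite (@sum_bool_range n (fun k => k < n - d)%N 0 (n - d)); last by lia.
rewrite (@sum_bool_range n c (d - 1 - n) (d - 1)); last by [].
(* [[e - 1, e - o)] is the single index [e - 1] for even [d] and empty for odd [d]. *)
rewrite (@sum_bool_range n q (e - 1) (e - o)); last by rewrite /q; lia.
rewrite (@sum_bool_range n (fun k => k.+1 == d) (d - 1) d); last by lia.
rewrite (@sum_bool_range n (fun k => (d <= k) && (k < n - d))%N d (n - d)); last by lia.
rewrite (@sum_bool_range n (fun k => (k < n - d)%N && c k) 0 (minn (n - d) (d - 1))); last by
  rewrite /c; lia.
rewrite (@sum_bool_range n (fun k => (k < n - d)%N && q k) (e - 1) (minn (n - d) (e - o)));
  last by rewrite /q; lia.
rewrite (@sum_bool_range n (fun k => (k.+1 == d) && (k < n - d)%N) (d - 1) (minn d (n - d)));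
  last by lia.
have -> : (minn n n - d = n - d)%N by lia.
have -> : (minn n (n - d) - 0 = n - d)%N by lia.
have -> : (minn n d - (d - 1) = (d <= n))%N by lia.
have -> : (minn n (n - d) - d = n - d - d)%N by lia.
have -> : (minn n (minn (n - d) (d - 1)) - 0 = minn (n - d) (d - 1))%N by lia.
have -> : (minn n (minn (n - d) (e - o)) - (e - 1) = minn (n - d) (e - o) - (e - 1))%N by lia.
have -> : (minn n (minn d (n - d)) - (d - 1) = (d.*2 <= n))%N by lia.
ring.
Qed.
End HeightEq.

(** * Roots of height at most [d] *)

(* Six times an antidifference at [t] of
   [k |-> 4 x^2 + 2 y + 12 s (1 + x)], where [x = x0 + x1 k] and [y = y0 + y1 k]. *)
Definition psum6 (x0 x1 y0 y1 s t : int) : int :=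
  6 * (4 * x0 ^+ 2 + 2 * y0 + 12 * s * (1 + x0)) * t
  + 3 * (8 * x0 * x1 + 2 * y1 + 12 * s * x1) * (t * (t - 1))
  + 4 * x1 ^+ 2 * (t * (t - 1) * (2 * t - 1)).

Section HeightLe.
Variables (n e : nat) (o : bool).
Local Notation d := (e.*2 + o)%N.

Definition Ale k := minn k d.
Definition Ble k := minn (n - 1 - k) d.
(** [k < e] amounts to [k + k + 2 <= d]: the index [i = k] is then counted by the minimum and must
    be removed. *)
Definition Cle k := (minn n (d - 1 - k) - (k < e))%N.
Definition varterm k : int :=
  4 * ((Ale k)%:Z - (Ble k)%:Z + (Cle k)%:Z) ^+ 2
     + 2 * ((Ale k)%:Z + (Ble k)%:Z + (Cle k)%:Z)
     + 12 * (k < d)%N%:Z * (1 + ((Ale k)%:Z - (Ble k)%:Z + (Cle k)%:Z)).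

Lemma Var_le_sum :
  48 * Var (XPsi (posroots_le n d)) = (\sum_(0 <= k < n) varterm k)%:~R.
Proof.
rewrite (@Var_roots_in n (fun h => h <= d)%N Ale Ble Cle) // => k kn.
- by rewrite (@sum_ord_range n (fun i => i < k)%N (fun i => k - i <= d)%N (k - d) k) /Ale =>
    [|i]; lia.
- by rewrite (@sum_ord_range n (fun i => k < i)%N (fun i => i - k <= d)%N (k + 1) (k + 1 + d))
    /Ble => [|i]; lia.
- rewrite (@sum_ord_neq n (fun i => k + i + 2 <= d)%N) //.
  by rewrite (@sum_ord_range n xpredT (fun i => k + i + 2 <= d)%N 0 (d - 1 - k)) /Cle => [|i]; lia.
Qed.

(** On such a piece the summand is quadratic in [k], and induction on [b] telescopes [psum6]. *)
Lemma sum_term_affine a b (x0 x1 y0 y1 : int) (s : bool) : (a <= b)%N ->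
  (forall k, (a <= k < b)%N ->
     [/\ (Ale k)%:Z - (Ble k)%:Z + (Cle k)%:Z = x0 + x1 * k%:Z,
         (Ale k)%:Z + (Ble k)%:Z + (Cle k)%:Z = y0 + y1 * k%:Z
       & (k < d)%N = s]) ->
  6 * \sum_(a <= k < b) varterm k
  = psum6 x0 x1 y0 y1 s%:Z b%:Z - psum6 x0 x1 y0 y1 s%:Z a%:Z.
Proof.
elim: b => [|b IH] ab kP; first by rewrite (_ : a = 0%N) 1?big_geq ?mulr0 ?subrr //; lia.
case: (ltngtP a b.+1) ab => // [ab _|-> _]; last by rewrite big_geq // mulr0 subrr.
rewrite big_nat_recr //= mulrDr IH //; last by move=> k kb; apply: kP; lia.
have [|xE yE sE] := kP b; first by lia.
by rewrite /varterm xE yE sE /psum6 (_ : b.+1%:Z = b%:Z + 1); [ring|lia].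
Qed.

Ltac cases_le := rewrite /Ale /Ble /Cle; lia.

(** Breakpoints: at [e] the correction in [Cle] stops, at [d] [Ale] saturates and the short roots
    end, at [n - d] [Ble] starts to decrease. Here e <= d <= n - d. *)
Lemma sum_term_le_half : (d.*2 <= n)%N ->
  let D := 2 * e%:Z + o%:Z in let N := n%:Z in let E := e%:Z in
  6 * \sum_(0 <= k < n) varterm k =
    (psum6 (-2) 0 (2 * D - 2) 0 1 E - psum6 (-2) 0 (2 * D - 2) 0 1 0)
  + (psum6 (-1) 0 (2 * D - 1) 0 1 D - psum6 (-1) 0 (2 * D - 1) 0 1 E)
  + (psum6 0 0 (2 * D) 0 0 (N - D) - psum6 0 0 (2 * D) 0 0 D)
  + (psum6 (D - N + 1) 1 (D + N - 1) (-1) 0 N - psum6 (D - N + 1) 1 (D + N - 1) (-1) 0 (N - D)).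
Proof.
move=> dn D N E; have DE : D = d%:Z by rewrite /D; lia.
have NDE : N - D = (n - d)%N%:Z by rewrite /N DE; lia.
rewrite (@big_cat_nat _ _ _ e) /=; [|lia|lia].
rewrite (@big_cat_nat _ _ _ d e) /=; [|lia|lia].
rewrite (@big_cat_nat _ _ _ (n - d) d) /=; [|lia|lia].
set rhs := (X in _ = X); rewrite !mulrDr !addrA.
rewrite (@sum_term_affine 0 e (-2) 0 (2 * D - 2) 0 true) => [|//|k ?]; last by split; cases_le.
rewrite (@sum_term_affine e d (-1) 0 (2 * D - 1) 0 true) => [||k ?]; [|lia|by split; cases_le].
rewrite (@sum_term_affine d (n - d) 0 0 (2 * D) 0 false) => [||k ?]; [|lia|by split; cases_le].
rewrite (@sum_term_affine (n - d) n (D - N + 1) 1 (D + N - 1) (-1) false) => [||k ?]; [|lia|by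
  split; cases_le].
by rewrite /rhs NDE DE.
Qed.

(** Now e <= n - d <= d, the first inequality coming from 3d <= 2n. *)
Lemma sum_term_half_two_thirds : (d <= n)%N -> (n <= d.*2)%N -> (3 * d <= 2 * n)%N ->
  let D := 2 * e%:Z + o%:Z in let N := n%:Z in let E := e%:Z in
  6 * \sum_(0 <= k < n) varterm k =
    (psum6 (-2) 0 (2 * D - 2) 0 1 E - psum6 (-2) 0 (2 * D - 2) 0 1 0)
  + (psum6 (-1) 0 (2 * D - 1) 0 1 (N - D) - psum6 (-1) 0 (2 * D - 1) 0 1 E)
  + (psum6 (D - N) 1 (N + D - 2) (-1) 1 D - psum6 (D - N) 1 (N + D - 2) (-1) 1 (N - D))
  + (psum6 (D - N + 1) 1 (D + N - 1) (-1) 0 N - psum6 (D - N + 1) 1 (D + N - 1) (-1) 0 D).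
Proof.
move=> dn nd nd2 D N E; have DE : D = d%:Z by rewrite /D; lia.
have NDE : N - D = (n - d)%N%:Z by rewrite /N DE; lia.
rewrite (@big_cat_nat _ _ _ e) /=; [|lia|lia].
rewrite (@big_cat_nat _ _ _ (n - d) e) /=; [|lia|lia].
rewrite (@big_cat_nat _ _ _ d (n - d)) /=; [|lia|lia].
set rhs := (X in _ = X); rewrite !mulrDr !addrA.
rewrite (@sum_term_affine 0 e (-2) 0 (2 * D - 2) 0 true) => [|//|k ?]; last by split; cases_le.
rewrite (@sum_term_affine e (n - d) (-1) 0 (2 * D - 1) 0 true) => [||k ?]; [|lia|by split;
  cases_le].
rewrite (@sum_term_affine (n - d) d (D - N) 1 (N + D - 2) (-1) true) => [||k ?]; [|lia|by
  split; cases_le].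
rewrite (@sum_term_affine d n (D - N + 1) 1 (D + N - 1) (-1) false) => [||k ?]; [|lia|by split;
  cases_le].
by rewrite /rhs NDE DE.
Qed.

(** From 2n/3 on, [n - d] comes before [e]: n - d <= e <= d. *)
Lemma sum_term_two_thirds_n : (d <= n)%N -> (2 * n <= 3 * d)%N ->
  let D := 2 * e%:Z + o%:Z in let N := n%:Z in let E := e%:Z in
  6 * \sum_(0 <= k < n) varterm k =
    (psum6 (-2) 0 (2 * D - 2) 0 1 (N - D) - psum6 (-2) 0 (2 * D - 2) 0 1 0)
  + (psum6 (D - N - 1) 1 (N + D - 3) (-1) 1 E - psum6 (D - N - 1) 1 (N + D - 3) (-1) 1 (N - D))
  + (psum6 (D - N) 1 (N + D - 2) (-1) 1 D - psum6 (D - N) 1 (N + D - 2) (-1) 1 E)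
  + (psum6 (D - N + 1) 1 (D + N - 1) (-1) 0 N - psum6 (D - N + 1) 1 (D + N - 1) (-1) 0 D).
Proof.
move=> dn nd D N E; have DE : D = d%:Z by rewrite /D; lia.
have NDE : N - D = (n - d)%N%:Z by rewrite /N DE; lia.
rewrite (@big_cat_nat _ _ _ (n - d)) /=; [|lia|lia].
rewrite (@big_cat_nat _ _ _ e (n - d)) /=; [|lia|lia].
rewrite (@big_cat_nat _ _ _ d e) /=; [|lia|lia].
set rhs := (X in _ = X); rewrite !mulrDr !addrA.
rewrite (@sum_term_affine 0 (n - d) (-2) 0 (2 * D - 2) 0 true) => [|//|k ?]; last by split;
  cases_le.
rewrite (@sum_term_affine (n - d) e (D - N - 1) 1 (N + D - 3) (-1) true) => [||k ?]; [|lia|by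
  split; cases_le].
rewrite (@sum_term_affine e d (D - N) 1 (N + D - 2) (-1) true) => [||k ?]; [|lia|by split;
  cases_le].
rewrite (@sum_term_affine d n (D - N + 1) 1 (D + N - 1) (-1) false) => [||k ?]; [|lia|by split;
  cases_le].
by rewrite /rhs NDE DE.
Qed.

(** [Ale] and [Ble] are no longer capped by [d]; instead the cap [n] in [Cle] is active below
    [d - n], and d - n <= e <= n. *)
Lemma sum_term_ge_n : (n <= d)%N -> (d <= 2 * n - 1)%N ->
  let D := 2 * e%:Z + o%:Z in let N := n%:Z in let E := e%:Z in
  6 * \sum_(0 <= k < n) varterm k =
    (psum6 0 2 (2 * N - 2) 0 1 (D - N) - psum6 0 2 (2 * N - 2) 0 1 0)
  + (psum6 (D - N - 1) 1 (N + D - 3) (-1) 1 E - psum6 (D - N - 1) 1 (N + D - 3) (-1) 1 (D - N))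
  + (psum6 (D - N) 1 (N + D - 2) (-1) 1 N - psum6 (D - N) 1 (N + D - 2) (-1) 1 E).
Proof.
move=> nd dn D N E; have DE : D = d%:Z by rewrite /D; lia.
have NDE : D - N = (d - n)%N%:Z by rewrite /N DE; lia.
rewrite (@big_cat_nat _ _ _ (d - n)) /=; [|lia|lia].
rewrite (@big_cat_nat _ _ _ e (d - n)) /=; [|lia|lia].
set rhs := (X in _ = X); rewrite !mulrDr !addrA.
rewrite (@sum_term_affine 0 (d - n) 0 2 (2 * N - 2) 0 true) => [|//|k ?]; last by split; cases_le.
rewrite (@sum_term_affine (d - n) e (D - N - 1) 1 (N + D - 3) (-1) true) => [||k ?]; [|lia|by
  split; cases_le].
rewrite (@sum_term_affine e n (D - N) 1 (N + D - 2) (-1) true) => [||k ?]; [|lia|by split;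
  cases_le].
by rewrite /rhs NDE.
Qed.
End HeightLe.

(** * The piecewise formulas *)

(* The arguments [a, c, q, s] count, respectively, the [k] with [d <= k], those in the
   range of [C], the one excluded from that range when [k.+1.*2 = d], and the
   short root; [ab, bc, bq, bs] count overlaps with [k < n - d]. *)
Lemma Var_eqE n e (o : bool) (a c q s ab bc bq bs : int) :
  let d := (e.*2 + o)%N in (0 < d)%N ->
  (n - d)%N%:Z = a -> (minn n (d - 1) - (d - 1 - n))%N%:Z = c ->
  (minn n (e - o) - (e - 1))%N%:Z = q -> (d <= n)%N%:Z = s ->
  (n - d - d)%N%:Z = ab -> (minn (n - d) (d - 1))%N%:Z = bc ->
  (minn (n - d) (e - o) - (e - 1))%N%:Z = bq -> (d.*2 <= n)%N%:Z = bs ->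
  Var (XPsi (posroots_eq n d)) =
  (12 * a + 6 * c - 6 * q + 12 * s - 8 * ab - 8 * bc + 8 * bq - 12 * bs)%:~R / 48.
Proof. by move=> d d0 <- <- <- <- <- <- <- <-; rewrite -Var_eq_count //; field. Qed.

(** 288 is 48 times the factor 6 of [psum6]. *)
Lemma Var_leE n e (o : bool) (z : int) :
  6 * \sum_(0 <= k < n) varterm n e o k = z ->
  Var (XPsi (posroots_le n (e.*2 + o))) = z%:~R / 288.
Proof. by move=> <-; rewrite rmorphM /= -Var_le_sum; field. Qed.

Section Formulas.
Variables (n e : nat) (o : bool).
Local Notation d := (e.*2 + o)%N.
Hypotheses (d_gt0 : (0 < d)%N) (d_le : (d <= 2 * n - 1)%N).
Local Notation V := (Var (XPsi (posroots_eq n d))).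
Local Notation U := (Var (XPsi (posroots_le n d))).
Local Notation D := (2 * e%:R + o%:R : rat).
Local Notation N := (n%:R : rat).
Local Notation Dz := (2 * e%:Z + o%:Z).
Local Notation Nz := n%:Z.

(** The constants encode both parities through [o]: here [(2 - o) / 24] is 1/12 or 1/24. *)
Lemma Var_eq_le_half : (2 * d <= n)%N ->
  V = D / 24 + N / 12 + (2 - o%:R) / 24.
Proof.
move: d_gt0 d_le => d0 dle h.
rewrite (@Var_eqE _ _ _ (Nz - Dz) (Dz - 1) (1 - o%:Z) 1 (Nz - 2 * Dz) (Dz - 1) (1 - o%:Z) 1) //.
  by case: (o) => /=; field.
all: by move: d0 dle h; case: (o) => ? ? *; lia.
Qed.

Lemma Var_eq_half_two_thirds : (n < 2 * d)%N -> (3 * d <= 2 * n)%N ->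
  V = D / 24 + N / 12 + (4 - o%:R) / 24.
Proof.
move: d_gt0 d_le => d0 dle h h'.
rewrite (@Var_eqE _ _ _ (Nz - Dz) (Dz - 1) (1 - o%:Z) 1 0 (Nz - Dz) (1 - o%:Z) 0) //.
  by case: (o) => /=; field.
all: by move: d0 dle h h'; case: (o) => ? ? *; lia.
Qed.

(** The [o] in the hypothesis makes it strict exactly for even [d]. In that case [e - 1] is no
    longer below [n - d], so [bq] falls from 1 to 0 and the constant by 8/48 = 1/6. *)
Lemma Var_eq_two_thirds_n : (2 * n < 3 * d + o)%N -> (d <= n)%N ->
  V = D / 24 + N / 12 + 3 * o%:R / 24.
Proof.
move: d_gt0 d_le => d0 dle h h'.
rewrite (@Var_eqE _ _ _ (Nz - Dz) (Dz - 1) (1 - o%:Z) 1 0 (Nz - Dz) 0 0) //.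
  by case: (o) => /=; field.
all: by move: d0 dle h h'; case: (o) => ? ? *; lia.
Qed.

Lemma Var_eq_ge_n : (n <= d)%N ->
  V = - D / 8 + N / 4 + o%:R / 8.
Proof.
move: d_gt0 d_le => d0 dle h.
(* At [d = n] the short root e_n still has height [d], but the range [c] is shorter by 2 than the
   formula for [d > n]; as 12 - 6 * 2 = 0, the two effects cancel. *)
rewrite (@Var_eqE _ _ _ 0 (2 * Nz - Dz + 1 - 2 * (d <= n)%N%:Z)
  (1 - o%:Z) (d <= n)%N%:Z 0 0 0 0) //.
  by case: (o) => /=; field.
all: by move: d0 dle h; case: (o) => ? ? *; lia.
Qed.

Lemma Var_le_le_half : (2 * d <= n)%N ->
  U = D ^+ 3 / 36 + D ^+ 2 / 48 + (N / 12 + 1 / 72) * D + o%:R / 48.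
Proof.
move=> h; rewrite (Var_leE (@sum_term_le_half n e o _)); last by lia.
by rewrite /psum6; case: o => /=; field.
Qed.

(** Here the [o] makes the hypothesis strict exactly for odd [d]. *)
Lemma Var_le_half_two_thirds : (n <= 2 * d)%N -> (3 * d + o <= 2 * n)%N ->
  U = D ^+ 3 / 36 + 3 / 16 * D ^+ 2 + (- N / 12 + 7 / 72) * D
      + (N ^+ 2 / 24 - N / 24 + o%:R / 48).
Proof.
move=> h h'; rewrite (Var_leE (@sum_term_half_two_thirds n e o _ _ _)); [|lia|lia|lia].
by rewrite /psum6; case: o => /=; field.
Qed.

Lemma Var_le_two_thirds_n : (2 * n <= 3 * d)%N -> (d <= n)%N ->
  U = D ^+ 3 / 36 + (N / 6 + (9 * o%:R - 2) / 72) * D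
      + (- N ^+ 2 / 24 + (1 - 2 * o%:R) * N / 24 + o%:R / 24).
Proof.
move=> h h'; rewrite (Var_leE (@sum_term_two_thirds_n n e o _ _)) //.
by rewrite /psum6; case: o => /=; field.
Qed.

Lemma Var_le_ge_n : (n <= d)%N ->
  U = - D ^+ 3 / 12 + (N / 3 - 1 / 24) * D ^+ 2
      + (- N ^+ 2 / 3 + N / 6 + (3 * o%:R - 1) / 24) * D
      + (N ^+ 3 / 9 + (2 - 3 * o%:R) * N / 36 + o%:R / 24).
Proof.
move=> h; rewrite (Var_leE (@sum_term_ge_n n e o _ _)) //.
by rewrite /psum6; case: o => /=; field.
Qed.
End Formulas.

Unset Implicit Arguments.

Theorem theoremA4 (n d : nat) :
  (1 <= d)%N -> (d <= 2 * n - 1)%N ->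
  let D : rat := d%:R in
  let N : rat := n%:R in
  let V := Var (XPsi (posroots_eq n d)) in
  let U := Var (XPsi (posroots_le n d)) in
  (* Var(X_{Phi^+_{=d}}) *)
  (
  ((2 * d <= n)%N -> ~~ odd d -> V = D / 24%:R + N / 12%:R + 1 / 12%:R) /\
      ((2 * d <= n)%N -> odd d -> V = D / 24%:R + N / 12%:R + 1 / 24%:R) /\
      ((n < 2 * d)%N -> (3 * d <= 2 * n)%N -> ~~ odd d ->
         V = D / 24%:R + N / 12%:R + 1 / 6%:R) /\
      ((n < 2 * d)%N -> (3 * d <= 2 * n)%N -> odd d ->
         V = D / 24%:R + N / 12%:R + 1 / 8%:R) /\
      ((2 * n < 3 * d)%N -> (d <= n)%N -> ~~ odd d ->
         V = D / 24%:R + N / 12%:R) /\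
      ((2 * n <= 3 * d)%N -> (d <= n)%N -> odd d ->
         V = D / 24%:R + N / 12%:R + 1 / 8%:R) /\
      ((n <= d)%N -> ~~ odd d -> V = - D / 8%:R + N / 4%:R) /\
      ((n <= d)%N -> odd d -> V = - D / 8%:R + N / 4%:R + 1 / 8%:R))
  /\
  (* Var(X_{Phi^+_{<=d}}) *)
  (
  ((2 * d <= n)%N -> ~~ odd d ->
         U = D ^+ 3 / 36%:R + D ^+ 2 / 48%:R + (N / 12%:R + 1 / 72%:R) * D) /\
      ((2 * d <= n)%N -> odd d ->
         U = D ^+ 3 / 36%:R + D ^+ 2 / 48%:R + (N / 12%:R + 1 / 72%:R) * D
             + 1 / 48%:R) /\
      ((n <= 2 * d)%N -> (3 * d <= 2 * n)%N -> ~~ odd d ->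
         U = D ^+ 3 / 36%:R + 3%:R / 16%:R * D ^+ 2
             + (- N / 12%:R + 7%:R / 72%:R) * D
             + (N ^+ 2 / 24%:R - N / 24%:R)) /\
      ((n <= 2 * d)%N -> (3 * d < 2 * n)%N -> odd d ->
         U = D ^+ 3 / 36%:R + 3%:R / 16%:R * D ^+ 2
             + (- N / 12%:R + 7%:R / 72%:R) * D
             + (N ^+ 2 / 24%:R - N / 24%:R + 1 / 48%:R)) /\
      ((2 * n <= 3 * d)%N -> (d <= n)%N -> ~~ odd d ->
         U = D ^+ 3 / 36%:R + (N / 6%:R - 1 / 36%:R) * D
             + (- N ^+ 2 / 24%:R + N / 24%:R)) /\
      ((2 * n <= 3 * d)%N -> (d <= n)%N -> odd d ->
         U = D ^+ 3 / 36%:R + (N / 6%:R + 7%:R / 72%:R) * D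
             + (- N ^+ 2 / 24%:R - N / 24%:R + 1 / 24%:R)) /\
      ((n <= d)%N -> ~~ odd d ->
         U = - D ^+ 3 / 12%:R + (N / 3%:R - 1 / 24%:R) * D ^+ 2
             + (- N ^+ 2 / 3%:R + N / 6%:R - 1 / 24%:R) * D
             + (N ^+ 3 / 9%:R + N / 18%:R)) /\
      ((n <= d)%N -> odd d ->
         U = - D ^+ 3 / 12%:R + (N / 3%:R - 1 / 24%:R) * D ^+ 2
             + (- N ^+ 2 / 3%:R + N / 6%:R + 1 / 12%:R) * D
             + (N ^+ 3 / 9%:R - N / 36%:R + 1 / 24%:R))).
Proof.
(* With [d] replaced by [e.*2 + o], the later case split on [o] decides the parity hypotheses. *)
move: (odd_double_half d); rewrite addnC; move: d./2 (odd d) => e o <- d0 dle D N V U.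
have DE : D = 2 * e%:R + o%:R by rewrite /D natrD -muln2 natrM mulrC.
rewrite /V /U DE /N.
case: o d0 dle {D N V U DE} => d0 dle; (do 2?split); do ?[apply: conj] => // h.
all: try move=> h'; try by []; try move=> _.
(* Each clause tries the regimes in turn; [lia] rejects those whose range conditions do not
   follow. *)
all: first
  [ by rewrite Var_eq_le_half //; first [lia | rewrite /=; field]
  | by rewrite Var_eq_half_two_thirds //; first [lia | rewrite /=; field]
  | by rewrite Var_eq_two_thirds_n //; first [lia | rewrite /=; field]
  | by rewrite Var_eq_ge_n //; first [lia | rewrite /=; field]
  | by rewrite Var_le_le_half //; first [lia | rewrite /=; field]
  | by rewrite Var_le_half_two_thirds //; first [lia | rewrite /=; field]
  | by rewrite Var_le_two_thirds_n //; first [lia | rewrite /=; field]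
  | by rewrite Var_le_ge_n //; first [lia | rewrite /=; field] ].
Qed.
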